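(* Let $X$ be a Banach lattice. The un-topology on $X$ is metrizable if and only if $X$ has a quasi-interior point. Moreover, if $e\in X_+$ is a quasi-interior point of $X$, then $d(x,y)=\bigl\lVert |x-y|\wedge e\bigr\rVert$ (for $x,y\in X$) is a metric on $X$ which induces the un-topology.
   Context: Let $X$ be a Banach lattice with positive cone $X_+$. A net $(x_\alpha)$ in $X$ un-converges to $x\in X$ if $\bigl\lVert |x_\alpha-x|\wedge u\bigr\rVert\to 0$ for every $u\in X_+$. The un-topology on $X$ is the linear topology whose base of zero neighborhoods is given by the sets $V_{\varepsilon,u}=\{x\in X : \lVert |x|\wedge u\rVert<\varepsilon\}$, where $\varepsilon>0$ and $0\ne u\in X_+$; convergence of nets in this topology is exactly un-convergence. A vector $e\in X_+$ is a quasi-interior point if the norm closure of the principal ideal $I_e$ generated by $e$ is $X$; equivalently, $\lVert x - x\wedge ne\rVert\to 0$ as $n\to\infty$ for every $x\in X_+$. *)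

(* Defs.v *)
From HB Require Import structures.
From mathcomp Require Import all_boot all_order all_algebra.
From mathcomp Require Import all_classical all_reals all_analysis.
Set Implicit Arguments.
Unset Strict Implicit.
Unset Printing Implicit Defensive.
Import Order.TTheory GRing.Theory Num.Theory.
Import numFieldNormedType.Exports.
Local Open Scope classical_set_scope.
Local Open Scope ring_scope.

Reserved Notation "x <=v y" (at level 70, y at next level, no associativity).

(* Vector lattices (Riesz spaces). The order is a field of the mixin: the
   order and module hierarchies of the library have no joins in which vector
   lattices and the existing ordered rings would both fit. *)
HB.mixin Record isVectorLattice (R : numDomainType) X & GRing.Lmodule R X := {
  vle : rel X ;
  vmeet : X -> X -> X ;
  vjoin : X -> X -> X ;
  vle_refl : reflexive vle ;
  vle_antisym : antisymmetric vle ;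
  vle_transitive : transitive vle ;
  vle_meet : forall x y z : X, vle x (vmeet y z) = vle x y && vle x z ;
  vjoin_le : forall x y z : X, vle (vjoin x y) z = vle x z && vle y z ;
  vleD2r_subproof : forall z x y : X, vle x y -> vle (x + z) (y + z) ;
  vleZ_subproof : forall (a : R) (x y : X), 0 <= a -> vle x y -> vle (a *: x) (a *: y)
}.

#[short(type="vectorLatticeType")]
HB.structure Definition VectorLattice (R : numDomainType) :=
  {X of GRing.Lmodule R X & isVectorLattice R X}.

Notation "x <=v y" := (vle x y) : ring_scope.

(* The lattice modulus |x|, as opposed to the norm [`|x|]. *)
Definition modulus (R : numDomainType) (X : vectorLatticeType R) (x : X) : X :=
  vjoin x (- x).

HB.mixin Record isBanachLattice (R : realType) X
    & CompleteNormedModule R X & VectorLattice R X := {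
  lattice_norm : forall x y : X, modulus x <=v modulus y -> `|x| <= `|y|
}.

#[short(type="banachLatticeType")]
HB.structure Definition BanachLattice (R : realType) :=
  {X of CompleteNormedModule R X & VectorLattice R X & isBanachLattice R X}.

Section VectorLatticeTheory.
Context {R : realType} {X : vectorLatticeType R}.
Implicit Types x y z t u : X.

Lemma vlexx x : x <=v x. Proof. exact: vle_refl. Qed.

Lemma vle_anti x y : (x <=v y) && (y <=v x) -> x = y.
Proof. exact: vle_antisym. Qed.

Lemma vle_trans y x z : x <=v y -> y <=v z -> x <=v z.
Proof. exact: vle_transitive. Qed.

Lemma vleD2r z x y : x <=v y -> x + z <=v y + z.
Proof. exact: vleD2r_subproof. Qed.

Lemma vleZ (a : R) x y : 0 <= a -> x <=v y -> a *: x <=v a *: y.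
Proof. exact: vleZ_subproof. Qed.

Lemma vmeet_lel x y : vmeet x y <=v x.
Proof. by have := vlexx (vmeet x y); rewrite vle_meet => /andP[]. Qed.

Lemma vmeet_ler x y : vmeet x y <=v y.
Proof. by have := vlexx (vmeet x y); rewrite vle_meet => /andP[]. Qed.

Lemma vjoin_gel x y : x <=v vjoin x y.
Proof. by have := vlexx (vjoin x y); rewrite vjoin_le => /andP[]. Qed.

Lemma vjoin_ger x y : y <=v vjoin x y.
Proof. by have := vlexx (vjoin x y); rewrite vjoin_le => /andP[]. Qed.

Lemma vjoinC x y : vjoin x y = vjoin y x.
Proof.
by apply: vle_anti; rewrite !vjoin_le !vjoin_gel !vjoin_ger.
Qed.

Lemma vmeet_idl x y : x <=v y -> vmeet x y = x.
Proof. by move=> xy; apply: vle_anti; rewrite vmeet_lel vle_meet vlexx. Qed.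

Lemma vmeet_le2 x y z t : x <=v z -> y <=v t -> vmeet x y <=v vmeet z t.
Proof.
by move=> xz yt; rewrite vle_meet (vle_trans (vmeet_lel _ _) xz)
  (vle_trans (vmeet_ler _ _) yt).
Qed.

Lemma vleD x y z t : x <=v y -> z <=v t -> x + z <=v y + t.
Proof.
move=> xy zt; apply: (vle_trans (vleD2r z xy)).
by rewrite ![y + _]addrC; exact: vleD2r.
Qed.

Lemma vge0D x y : 0 <=v x -> 0 <=v y -> 0 <=v x + y.
Proof. by move=> x0 y0; rewrite -[0]addr0; exact: vleD. Qed.

Lemma modulus_ge x : x <=v modulus x.
Proof. exact: vjoin_gel. Qed.

Lemma modulus_geN x : - x <=v modulus x.
Proof. exact: vjoin_ger. Qed.

Lemma modulus_ge0 x : 0 <=v modulus x.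
Proof.
have : 0 <=v modulus x + modulus x.
  by rewrite -(subrr x); exact: vleD (modulus_ge _) (modulus_geN _).
have h0 : 0 <= 2^-1 :> R by rewrite invr_ge0.
move=> /(vleZ h0).
by rewrite scaler0 scalerDr -scalerDl -div1r -splitr scale1r.
Qed.

Lemma modulus_id x : 0 <=v x -> modulus x = x.
Proof.
move=> x0; apply: vle_anti; rewrite vjoin_gel vjoin_le vlexx/= andbT.
apply: (vle_trans _ x0); have := vleD2r (- x) x0.
by rewrite add0r subrr.
Qed.

Lemma modulus0 : modulus (0 : X) = 0.
Proof. exact/modulus_id/vlexx. Qed.

Lemma modulusN x : modulus (- x) = modulus x.
Proof. by rewrite /modulus opprK vjoinC. Qed.

Lemma modulusD x y : modulus (x + y) <=v modulus x + modulus y.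
Proof.
by rewrite vjoin_le opprD !vleD// ?modulus_ge ?modulus_geN.
Qed.

Lemma modulusZ_le (a : R) x : modulus (a *: x) <=v `|a| *: modulus x.
Proof.
wlog a0 : a / 0 <= a => [ge0|].
  have [/ge0//|a0] := leP 0 a.
  by rewrite -modulusN -scaleNr -normrN; apply: ge0; rewrite oppr_ge0 ltW.
by rewrite ger0_norm// vjoin_le -scalerN !vleZ// ?modulus_ge ?modulus_geN.
Qed.

Lemma vmeetDr x y z : vmeet (x + z) (y + z) = vmeet x y + z.
Proof.
apply: vle_anti; apply/andP; split; last first.
  by rewrite vle_meet !vleD2r ?vmeet_lel ?vmeet_ler.
rewrite -[X in X <=v _](subrK z); apply: vleD2r; rewrite vle_meet.
apply/andP; split.
  by rewrite -[X in _ <=v X](addrK z); exact/vleD2r/vmeet_lel.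
by rewrite -[X in _ <=v X](addrK z); exact/vleD2r/vmeet_ler.
Qed.

Lemma vmeetD_le x y u : 0 <=v x -> 0 <=v y -> 0 <=v u ->
  vmeet (x + y) u <=v vmeet x u + vmeet y u.
Proof.
move=> x0 y0 u0; have geD v : 0 <=v v -> u <=v v + u.
  by move=> v0; rewrite -[X in X <=v _]add0r; exact: vleD2r.
have le_u v w : 0 <=v w -> vmeet v u <=v w + u.
  by move=> w0; exact: vle_trans (vmeet_ler _ _) (geD _ w0).
rewrite -vmeetDr vle_meet ![_ + vmeet y u]addrC -!vmeetDr !vle_meet.
by rewrite (addrC y x) vmeet_lel (addrC u x) !le_u.
Qed.

End VectorLatticeTheory.

Section UnTopology.
Context {R : realType} {X : banachLatticeType R}.
Implicit Types x y z u : X.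

Lemma ler_lattice_norm x y : 0 <=v x -> x <=v y -> `|x| <= `|y|.
Proof.
move=> x0 xy; apply: lattice_norm.
by rewrite !modulus_id//; exact: vle_trans xy.
Qed.

Lemma meet_modulus_ge0 x u : 0 <=v u -> 0 <=v vmeet (modulus x) u.
Proof. by move=> u0; rewrite vle_meet modulus_ge0. Qed.

Definition un_cvg (F : set_system X) (x : X) : Prop :=
  forall u, 0 <=v u -> `|vmeet (modulus (y - x)) u| @[y --> F] --> (0 : R).

(* The basic zero neighborhood V_{e,u}. *)
Definition un_ball0 (e : R) (u : X) : set X :=
  [set x | `|vmeet (modulus x) u| < e].

(* Since V_{e,0} = X, allowing u = 0 does not change the filter when X is
   nonzero; it keeps the base nonempty when X = {0}. *)
Definition un_nbhs (x : X) : set_system X :=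
  filter_from [set eu : R * X | 0 < eu.1 /\ 0 <=v eu.2]
    (fun eu => [set y | un_ball0 eu.1 eu.2 (y - x)]).

Lemma un_nbhs_neq0 (w x : X) : w != 0 ->
  un_nbhs x = filter_from [set eu : R * X | [/\ 0 < eu.1, 0 <=v eu.2 & eu.2 != 0]]
    (fun eu => [set y | un_ball0 eu.1 eu.2 (y - x)]).
Proof.
move=> w0; apply/seteqP; split => A [[e u] /= eu sA]; last first.
  by case: eu => e0 u0 _; exists (e, u).
have [e0 u0] := eu; have [uE|u_neq0] := eqVneq u 0; last by exists (e, u).
exists (e, modulus w) => /=.
  split => //; first exact: modulus_ge0.
  apply: contra_neq w0 => mw0; apply/eqP; rewrite -normr_le0 -(normr0 X).
  by apply: lattice_norm; rewrite mw0 modulus0 vlexx.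
move=> y _; apply: sA; rewrite /un_ball0/= uE.
suff -> : vmeet (modulus (y - x)) 0 = 0 by rewrite normr0.
by apply: vle_anti; rewrite vmeet_ler meet_modulus_ge0// vlexx.
Qed.

End UnTopology.

(* A copy of the Banach lattice X whose topology is the un-topology instead of
   the norm topology. *)
Definition un_space (R : realType) (X : banachLatticeType R) : Type := X.

Section UnSpace.
Context {R : realType} {X : banachLatticeType R}.

HB.instance Definition _ := Choice.on (un_space X).
HB.instance Definition _ := hasNbhs.Build (un_space X) (@un_nbhs R X).

Let un_nbhs_filter (x : un_space X) : ProperFilter (nbhs x).
Proof.
apply: filter_from_proper; last first.
  move=> -[e u] [/= e0 u0]; exists x; rewrite /un_ball0/= subrr modulus0.
  by rewrite (vmeet_idl u0) normr0.
apply: filter_from_filter; first by exists (1, 0); split => //=; exact: vlexx.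
move=> [e u] [f v] /= [e0 u0] [f0 v0]; exists (Order.min e f, u + v).
  by rewrite /= lt_min e0 f0; split => //; exact: vge0D.
move=> y; rewrite /un_ball0/= lt_min => /andP[ye yf]; split.
- apply: le_lt_trans ye; apply: ler_lattice_norm; first exact: meet_modulus_ge0.
  apply: vmeet_le2; first exact: vlexx.
  by rewrite -[X in X <=v _]addr0; apply: vleD => //; exact: vlexx.
- apply: le_lt_trans yf; apply: ler_lattice_norm; first exact: meet_modulus_ge0.
  apply: vmeet_le2; first exact: vlexx.
  by rewrite -[X in X <=v _]add0r; apply: vleD => //; exact: vlexx.
Qed.

Let un_nbhs_singleton (x : un_space X) (A : set (un_space X)) :
  nbhs x A -> A x.
Proof.
move=> [[e u] /= [e0 u0]]; apply; rewrite /un_ball0/= subrr modulus0.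
by rewrite (vmeet_idl u0) normr0.
Qed.

Let un_nbhs_nbhs (x : un_space X) (A : set (un_space X)) :
  nbhs x A -> nbhs x (nbhs^~ A).
Proof.
move=> [[e u] /= [e0 u0] sA].
have he0 : 0 < e / 2 by rewrite divr_gt0.
exists (e / 2, u) => // y xy; exists (e / 2, u) => // z yz.
apply: sA; rewrite /un_ball0/=.
have mD : modulus ((z : X) - (x : X)) <=v
    modulus ((z : X) - (y : X)) + modulus ((y : X) - (x : X)).
  by apply: vle_trans (modulusD _ _); rewrite addrA subrK; exact: vlexx.
rewrite [e]splitr (le_lt_trans _ (ltrD yz xy))//.
apply: le_trans (ler_normD _ _); apply: ler_lattice_norm.
  exact: meet_modulus_ge0.
apply: vle_trans (vmeetD_le (modulus_ge0 _) (modulus_ge0 _) u0).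
by apply: vmeet_le2 => //; exact: vlexx.
Qed.

HB.instance Definition _ := Nbhs_isNbhsTopological.Build (un_space X)
  un_nbhs_filter un_nbhs_singleton un_nbhs_nbhs.

Lemma un_space_cvgE (F : set_system X) (x : X) : Filter F ->
  (F : set_system (un_space X)) --> (x : un_space X) <-> un_cvg F x.
Proof.
move=> FF; split.
- move=> Fx u u0; apply/cvgrPdist_lt => e e0.
  have /Fx : nbhs (x : un_space X) [set y : X | un_ball0 e u (y - x)].
    by exists (e, u).
  by apply: filterS => y; rewrite /= sub0r normrN normr_id.
- move=> Fx A [[e u] /= [e0 u0] sA].
  have /cvgrPdist_lt/(_ _ e0) := Fx u u0; apply: filterS => y.
  by rewrite sub0r normrN normr_id => ?; exact: sA.
Qed.

End UnSpace.

Section QuasiInterior.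
Context {R : realType} {X : banachLatticeType R}.

Definition lattice_ideal (I : set X) : Prop :=
  [/\ I 0, forall (a : R) (x y : X), I x -> I y -> I (a *: x + y) &
      forall x y : X, modulus x <=v modulus y -> I y -> I x].

Definition principal_ideal (e : X) : set X := smallest lattice_ideal [set e].

(* The closure is that of the norm topology of X. *)
Definition quasi_interior_point (e : X) : Prop :=
  0 <=v e /\ closure (principal_ideal e) = [set: X].

Lemma principal_idealE (e : X) : 0 <=v e ->
  principal_ideal e = [set x | exists2 l : R, 0 <= l & modulus x <=v l *: e].
Proof.
move=> e0; apply/seteqP; split.
- apply: smallest_sub; last first.
    by move=> _ ->; exists 1; rewrite ?ler01// scale1r modulus_id// vlexx.
  split.
  + by exists 0; rewrite // modulus0 scale0r vlexx.
  + move=> a x y [l l0 xl] [m m0 ym]; exists (`|a| * l + m).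
      by rewrite addr_ge0// mulr_ge0.
    apply: vle_trans (modulusD _ _) _; rewrite scalerDl -scalerA.
    apply: vleD => //; apply: vle_trans (modulusZ_le _ _) _.
    exact: vleZ.
  + by move=> x y xy [l l0 yl]; exists l => //; exact: vle_trans yl.
- move=> x [l l0 xl] A [[A0 AD As] Ae]; apply: (As _ (l *: e)).
    by apply: vle_trans xl _; exact: modulus_ge.
  by rewrite -[l *: e]addr0; apply: AD => //; exact: Ae.
Qed.

End QuasiInterior.

Section Metrizable.
Context {R : realType}.

Definition is_metric (T : Type) (d : T -> T -> R) : Prop :=
  [/\ forall x y, 0 <= d x y, forall x y, d x y = 0 <-> x = y,
      forall x y, d x y = d y x &
      forall x y z, d x z <= d x y + d y z].

Definition induces_topology (T : topologicalType) (d : T -> T -> R) : Prop :=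
  forall x : T,
    nbhs x = filter_from [set r : R | 0 < r] (fun r => [set y | d x y < r]).

End Metrizable.

Definition metrizable (R : realType) (T : topologicalType) : Prop :=
  exists d : T -> T -> R, is_metric d /\ induces_topology d.

Definition un_dist (R : realType) (X : banachLatticeType R) (e x y : X) : R :=
  `|vmeet (modulus (x - y)) e|.

(* Main.v *)
(* If e is quasi-interior, approximate u by y with |y| <= n e: then
   |z| /\ u <= n (|z| /\ e) + |u - y|, so |z| /\ e alone controls the
   un-topology.
   Conversely, a metric gives a countable base V_{a_k, u_k} at 0. Choose e with
   every u_k below a multiple of e (a weighted sum of the u_k). For x >= 0, the
   excess p_n = x - x /\ n e satisfies p_n /\ e <= x / n, so p_n /\ u_k -> 0 in
   norm for each k, i.e. p_n un-converges to 0; as p_n <= x, p_n = p_n /\ x -> 0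
   in norm. *)
Require Import Defs.
From HB Require Import structures.
From mathcomp Require Import all_boot all_order all_algebra.
From mathcomp Require Import all_classical all_reals all_analysis.
Set Implicit Arguments.
Unset Strict Implicit.
Unset Printing Implicit Defensive.
Local Open Scope classical_set_scope.
Local Open Scope ring_scope.
Import Order.TTheory GRing.Theory Num.Theory.
Import numFieldNormedType.Exports.

(** * Order inequalities in vector lattices *)

Section VectorLatticeFacts.
Context {R : realType} {X : vectorLatticeType R}.
Implicit Types (x y z u v e : X) (n : nat).

Lemma vsubr_ge0 x y : (0 <=v y - x) = (x <=v y).
Proof.
apply/idP/idP => [/(vleD2r x)|/(vleD2r (- x))]; first by rewrite add0r subrK.
by rewrite subrr.
Qed.

Lemma vmeetC x y : vmeet x y = vmeet y x.
Proof. by apply: vle_anti; rewrite !vle_meet !vmeet_lel !vmeet_ler. Qed.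

Lemma vmeet_ge0 x y : 0 <=v x -> 0 <=v y -> 0 <=v vmeet x y.
Proof. by move=> x0 y0; rewrite vle_meet x0. Qed.

Lemma vleMn n x y : x <=v y -> x *+ n <=v y *+ n.
Proof.
move=> xy; elim: n => [|n IHn]; first by rewrite !mulr0n vlexx.
by rewrite !mulrS; exact: vleD.
Qed.

Lemma vmulrn_ge0 n x : 0 <=v x -> 0 <=v x *+ n.
Proof. by move=> /(vleMn n); rewrite mul0rn. Qed.

Lemma vle_scale (a b : R) x : a <= b -> 0 <=v x -> a *: x <=v b *: x.
Proof.
move=> ab /(vleZ (_ : 0 <= b - a)); rewrite subr_ge0 => /(_ ab).
by rewrite scaler0 scalerBl vsubr_ge0.
Qed.

Lemma vleB x y : 0 <=v y -> x - y <=v x.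
Proof. by move=> y0; rewrite -vsubr_ge0 opprB addrC subrK. Qed.

Lemma vmeetDr_le x y u : 0 <=v x -> 0 <=v y -> 0 <=v u ->
  vmeet u (x + y) <=v vmeet u x + vmeet u y.
Proof. by rewrite !(vmeetC u); exact: vmeetD_le. Qed.

Lemma vmeetMnr_le n x y : 0 <=v x -> 0 <=v y ->
  vmeet x (y *+ n) <=v vmeet x y *+ n.
Proof.
move=> x0 y0; elim: n => [|n IHn]; first by rewrite !mulr0n vmeet_ler.
rewrite !mulrS; apply: vle_trans (vmeetDr_le y0 (vmulrn_ge0 n y0) x0) _.
by apply: vleD => //; exact: vlexx.
Qed.

Lemma vmeet_subr_meet x y : vmeet (x - vmeet x y) (y - vmeet x y) = 0.
Proof. by rewrite vmeetDr subrr. Qed.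

(* [n v - n v /\ n e] is [n (v - e)^+], which is disjoint from [(v - e)^-],
   while [e <= v + (v - e)^-]. *)
Lemma vmeet_excess_le n v e : 0 <=v v -> 0 <=v e ->
  vmeet (v *+ n - vmeet (v *+ n) (e *+ n)) e <=v v.
Proof.
move=> v0 e0; set m := vmeet v e.
have vm0 : 0 <=v v - m by rewrite vsubr_ge0 vmeet_lel.
have em0 : 0 <=v e - m by rewrite vsubr_ge0 vmeet_ler.
(* [m *+ n] lies below both [v *+ n] and [e *+ n]. *)
have le1 : v *+ n - vmeet (v *+ n) (e *+ n) <=v (v - m) *+ n.
  rewrite -vsubr_ge0 mulrnBl opprB addrC addrA subrK vsubr_ge0 vle_meet.
  by rewrite !vleMn// ?vmeet_lel ?vmeet_ler.
have le2 : e <=v v + (e - m).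
  by rewrite -vsubr_ge0 -addrA [e - m - e]addrC addKr.
apply: vle_trans (vmeet_le2 le1 le2) _.
apply: vle_trans (vmeetDr_le v0 em0 (vmulrn_ge0 n vm0)) _.
rewrite -[X in _ <=v X]addr0; apply: vleD; first exact: vmeet_ler.
(* Disjointness of [e - m] and [v - m] survives the multiple [n]. *)
rewrite vmeetC; apply: vle_trans (vmeetMnr_le n em0 vm0) _.
by rewrite vmeetC vmeet_subr_meet mul0rn vlexx.
Qed.

End VectorLatticeFacts.

(** * Norm, closed cone and series in Banach lattices *)

Section BanachLatticeFacts.
Context {R : realType} {X : banachLatticeType R}.
Implicit Types (x y z u v e : X).

Lemma modulus_idem x : modulus (modulus x) = modulus x.
Proof. exact/modulus_id/modulus_ge0. Qed.

Lemma norm_modulus x : `|modulus x| = `|x|.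
Proof.
by apply/eqP; rewrite eq_le !lattice_norm// modulus_idem vlexx.
Qed.

Lemma norm_le_eq0 x : (forall r : R, 0 < r -> `|x| <= r) -> x = 0.
Proof.
move=> xr; apply/eqP; rewrite -normr_le0.
by apply/ler_addgt0Pr => r r0; rewrite add0r xr.
Qed.

(** For every [y] in the cone, [- x <=v y - x], so the negative part of [x] lies below
    [modulus (y - x)]; its norm is therefore arbitrarily small. *)
Lemma vge0_closed x :
  (forall r : R, 0 < r -> exists2 y, 0 <=v y & `|y - x| < r) -> 0 <=v x.
Proof.
move=> apx; suff w0 : vjoin (- x) 0 = 0.
  have /(vleD2r x) := vjoin_gel (- x) 0.
  by rewrite w0 addNr add0r.
apply: norm_le_eq0 => r /apx[y y0 /ltW]; apply: le_trans.
rewrite -(norm_modulus (y - x)); apply: ler_lattice_norm.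
  exact: vjoin_ger.
rewrite vjoin_le modulus_ge0 andbT; apply: vle_trans (modulus_ge _).
by rewrite -[X in X <=v _]add0r; exact: vleD2r.
Qed.

Lemma natmul_bound (l : R) e : 0 <= l -> 0 <=v e ->
  exists n : nat, l *: e <=v e *+ n.
Proof.
move=> l0 e0; exists (Num.bound l); rewrite -scaler_nat; apply: vle_scale => //.
exact/ltW/archi_boundP.
Qed.

Lemma series_ge_term (v : X ^nat) (k n : nat) :
  (forall i, 0 <=v v i) -> (k < n)%N -> v k <=v series v n.
Proof.
move=> v0 kn; rewrite /series/= big_mkord (bigD1 (Ordinal kn))//=.
rewrite -vsubr_ge0 addrAC subrr add0r.
by elim/big_ind: _ => //; [exact: vlexx | exact: vge0D].
Qed.

Lemma series_limit_ge_term (v : X ^nat) (k : nat) :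
  (forall i, 0 <=v v i) -> cvgn (series v) -> v k <=v limn (series v).
Proof.
move=> v0 cv; rewrite -vsubr_ge0; apply: vge0_closed => r r0.
have /cvgrPdist_lt/(_ _ r0)[N _ NP] := cv.
(* [series v n] sums the indices below [n]: the bound [k.+1] includes the term [k], and [N] brings
   the partial sum within [r] of the limit. *)
exists (series v (maxn N k.+1) - v k).
  by rewrite vsubr_ge0 series_ge_term// leq_max leqnn orbT.
rewrite opprB addrA subrK distrC; apply: NP => /=.
by rewrite leq_maxl.
Qed.

Lemma countable_ideal_bound (u : nat -> X) : (forall k, 0 <=v u k) ->
  exists2 e, 0 <=v e & forall k, exists n : nat, u k <=v e *+ n.
Proof.
(* The weights dominate the series of norms by a geometric one, so completeness gives convergence;
   the [1 +] keeps the denominator positive when [u k = 0]. *)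
move=> u0; pose c k : R := 2^-1 ^+ k / (1 + `|u k|).
have d0 k : 0 < 1 + `|u k| by rewrite ltr_pwDl.
have c0 k : 0 < c k by rewrite divr_gt0// exprn_gt0// invr_gt0.
pose v k := c k *: u k.
have v0 k : 0 <=v v k by have := vleZ (ltW (c0 k)) (u0 k); rewrite scaler0.
have cv : cvgn (series v).
  apply: normed_cvg; apply: (@series_le_cvg _ _ (geometric 1 2^-1)) => //.
  - by move=> n; exact: normr_ge0.
  - by move=> n; apply: geometric_ge0; rewrite ?invr_ge0.
  - move=> n; rewrite /= mul1r normrZ gtr0_norm// mulrAC -mulrA.
    by rewrite ler_piMr ?exprn_ge0 ?invr_ge0// ler_pdivrMr// mul1r lerDr.
  - by apply: is_cvg_geometric_series; rewrite ger0_norm ?invr_ge0// invf_lt1 ?ltr1n.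
have ve k := series_limit_ge_term k v0 cv.
have e0 : 0 <=v limn (series v) by exact: vle_trans (v0 0%N) (ve 0%N).
exists (limn (series v)) => // k.
have cV0 : 0 <= (c k)^-1 by rewrite invr_ge0 ltW.
(* As [c k *: u k] is below the sum, [u k] is below [(c k)^-1] times it. *)
have [n ne] := natmul_bound cV0 e0; exists n; apply: vle_trans ne.
by have := vleZ cV0 (ve k); rewrite scalerA mulVf ?gt_eqF// scale1r.
Qed.

(** * Quasi-interior points and approximation *)

Lemma quasi_interior_approx e x (r : R) : quasi_interior_point e -> 0 < r ->
  exists2 y, exists2 l : R, 0 <= l & modulus y <=v l *: e & `|x - y| < r.
Proof.
move=> [e0 cl] r0; have : closure (principal_ideal e) x by rewrite cl.
move=> /(_ _ (nbhsx_ballx x _ r0)) [y]; rewrite principal_idealE// => -[yl].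
by rewrite -ball_normE => xy; exists y.
Qed.

(** Truncating the positive and negative parts of a vector by multiples of [e] approximates it from
    within the principal ideal. *)
Lemma quasi_interiorP e : 0 <=v e ->
  (forall x (r : R), 0 <=v x -> 0 < r ->
     exists n : nat, `|x - vmeet x (e *+ n)| < r) ->
  quasi_interior_point e.
Proof.
move=> e0 apx; split=> //; rewrite -subTset => x _ B /nbhs_ballP[r /= r0 rB].
(* [x - m] is the positive part of [x] and [- m] the negative part. *)
set m := vmeet x 0.
have r20 : 0 < r / 2 by rewrite divr_gt0.
have p0 : 0 <=v x - m by rewrite vsubr_ge0 vmeet_lel.
have n0 : 0 <=v - m by rewrite -[- m]add0r vsubr_ge0 vmeet_ler.
have [k kr] := apx _ _ p0 r20; have [l lr] := apx _ _ n0 r20.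
exists (vmeet (x - m) (e *+ k) - vmeet (- m) (e *+ l)); split.
  rewrite principal_idealE//; exists (k + l)%:R => //=.
  rewrite scaler_nat mulrnDr; apply: vle_trans (modulusD _ _) _.
  rewrite modulusN !modulus_id ?vmeet_ge0 ?vmulrn_ge0//.
  by rewrite vleD ?vmeet_ler.
apply: rB; rewrite -ball_normE/= [r]splitr.
apply: le_lt_trans (ltrD kr lr).
rewrite -[X in _ <= _ + X]normrN; apply: le_trans (ler_normD _ _).
by rewrite !opprB opprK [_ + m]addrC addrACA subrK [- _ + vmeet (- m) _]addrC.
Qed.

(* For [y] with [|y| <= l e] and [|u - y|] small,
   [|z| /\ u <= n (|z| /\ e) + |u - y|]. *)
Lemma quasi_interior_norm_meet_le e u (r : R) :
  quasi_interior_point e -> 0 <=v u -> 0 < r ->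
  exists n : nat, forall z,
    `|vmeet (modulus z) u| <= `|vmeet (modulus z) e| *+ n + r.
Proof.
move=> qe u0 r0; have e0 := qe.1.
have [y [l l0 yl] uy] := quasi_interior_approx u qe r0.
have [n ln] := natmul_bound l0 e0; exists n => z.
have z0 := modulus_ge0 z.
have ule : u <=v e *+ n + modulus (u - y).
  rewrite -[X in X <=v _](subrK y) addrC; apply: vleD; last exact: modulus_ge.
  by apply: vle_trans (modulus_ge _) _; exact: vle_trans yl ln.
have en0 := vmulrn_ge0 n e0.
apply: (@le_trans _ _ `|vmeet (modulus z) e *+ n + modulus (u - y)|).
  apply: ler_lattice_norm; first exact: vmeet_ge0.
  apply: vle_trans (vmeet_le2 (vlexx _) ule) _.
  apply: vle_trans (vmeetDr_le en0 (modulus_ge0 _) z0) _.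
  by apply: vleD; [exact: vmeetMnr_le | exact: vmeet_ler].
rewrite (le_trans (ler_normD _ _))// norm_modulus lerD ?(ltW uy)// -scaler_nat normrZ normr_nat mulr_natl//.
Qed.

(** * From a quasi-interior point to a metric *)

Lemma un_dist_metric e : quasi_interior_point e -> is_metric (un_dist e).
Proof.
move=> qe; have e0 := qe.1; split.
- by move=> x y; exact: normr_ge0.
- move=> x y; split=> [d0|->]; last first.
    by rewrite /un_dist subrr modulus0 vmeet_idl// normr0.
  apply/eqP; rewrite -subr_eq0; apply/eqP/norm_le_eq0 => r r0.
  (* Taking [u = modulus (x - y)] turns the left side of the bound into the norm of [x - y], while
     the term in [e] vanishes. *)
  have [n /(_ (x - y))] :=
    quasi_interior_norm_meet_le qe (modulus_ge0 (x - y)) r0.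
  rewrite vmeet_idl ?vlexx// norm_modulus.
  by rewrite [`|vmeet _ e|]d0 mul0rn add0r.
- by move=> x y; rewrite /un_dist -modulusN opprB.
- move=> x y z; apply: le_trans (ler_normD _ _).
  apply: ler_lattice_norm; first exact: vmeet_ge0 (modulus_ge0 _) e0.
  apply: vle_trans (vmeetD_le (modulus_ge0 _) (modulus_ge0 _) e0).
  apply: vmeet_le2; last exact: vlexx.
  by apply: vle_trans (modulusD _ _); rewrite addrA subrK vlexx.
Qed.

Lemma un_dist_induces e : quasi_interior_point e ->
  induces_topology (un_dist e : un_space X -> un_space X -> R).
Proof.
move=> qe x; apply/seteqP; split=> A.
- move=> [[r u] /= [r0 u0] sA].
  have r20 : 0 < r / 2 by rewrite divr_gt0.
  have [n nP] := quasi_interior_norm_meet_le qe u0 r20.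
  (* This radius makes [n] times the distance less than [r / 2]; the successor covers [n = 0]. *)
  exists (r / 2 / n.+1%:R) => /=; first by rewrite divr_gt0.
  move=> y; rewrite /= /un_dist ltr_pdivlMr// mulr_natr => xy; apply: sA.
  rewrite /un_ball0/= -modulusN opprB; apply: le_lt_trans (nP _) _.
  rewrite [ltRHS]splitr ltrD2r; apply: le_lt_trans xy.
  by rewrite mulrSr lerDl.
- move=> [r /= r0 sA]; exists (r, e); first by split=> //; exact: qe.1.
  by move=> y ye; apply: sA; rewrite /= /un_dist -modulusN opprB.
Qed.

(** * From a metric to a quasi-interior point *)

Lemma metrizable_countable_base : metrizable R (un_space X) ->
  exists (a : nat -> R) (u : nat -> X), [/\ forall k, 0 < a k,
    forall k, 0 <=v u k &
    forall (r : R) x, 0 < r -> 0 <=v x ->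
      exists k, un_ball0 (a k) (u k) `<=` un_ball0 r x].
Proof.
move=> [d [_ dtop]]; have d0 := dtop (0 : X).
(* A basic zero neighborhood is chosen inside each metric ball of radius [1 / (k + 1)] about 0. *)
have /choice[au auP] (k : nat) : exists au : R * X,
    [/\ 0 < au.1, 0 <=v au.2 &
      un_ball0 au.1 au.2 `<=` [set y : X | d (0 : X) y < k.+1%:R^-1]].
  have : nbhs (0 : un_space X) [set y : un_space X | d (0 : X) y < k.+1%:R^-1].
    by rewrite d0; exists k.+1%:R^-1 => //=; rewrite invr_gt0.
  move=> [[a u] /= [a0 u0] sA]; exists (a, u); split=> // y ay.
  by apply: sA; rewrite /= subr0.
exists (fst \o au), (snd \o au); split => [k|k|r x r0 x0];
  [by have [] := auP k | by have [] := auP k |].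
have : nbhs (0 : un_space X) [set y : un_space X | un_ball0 r x (y : X)].
  by exists (r, x) => // y; rewrite /= subr0.
rewrite d0 => -[s /= s0 ds]; pose k := Num.bound s^-1; exists k.
have [_ _ sub] := auP k; apply: subset_trans sub _ => y /= dy; apply: ds => /=.
apply: lt_trans dy _; rewrite invf_plt ?posrE//.
apply: lt_le_trans (archi_boundP _) _; first by rewrite invr_ge0 ltW.
by rewrite ler_nat.
Qed.

(** With [v = x / n], the meet of the excess with [e] is at most [v], so its meet with [u] is at
    most [v *+ m], of norm [m / n] times that of [x]. *)
Lemma norm_meet_excess_small e u x (r : R) (m : nat) :
  0 <=v e -> 0 <=v u -> u <=v e *+ m -> 0 <=v x -> 0 < r ->
  exists n : nat, `|vmeet (x - vmeet x (e *+ n)) u| < r.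
Proof.
move=> e0 u0 um x0 r0; pose n := (Num.bound ((`|x| *+ m) / r)).+1.
pose v := n%:R^-1 *: x.
have xE : x = v *+ n by rewrite -scaler_nat scalerA mulfV ?scale1r ?pnatr_eq0.
have v0 : 0 <=v v.
  by have := vleZ (_ : 0 <= n%:R^-1 :> R) x0; rewrite scaler0 invr_ge0; exact.
exists n; have p0 : 0 <=v x - vmeet x (e *+ n) by rewrite vsubr_ge0 vmeet_lel.
apply: (@le_lt_trans _ _ `|v *+ m|).
  apply: ler_lattice_norm; first exact: vmeet_ge0.
  apply: vle_trans (vmeet_le2 (vlexx _) um) _.
  apply: vle_trans (vmeetMnr_le m p0 e0) _; apply: vleMn.
  by rewrite [in X in X <=v _]xE; exact: vmeet_excess_le.
rewrite -scaler_nat normrZ normr_nat mulr_natl normrZ gtr0_norm ?invr_gt0// -mulrnAr mulrC ltr_pdivrMr//.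
rewrite -ltr_pdivrMl// mulrC; apply: lt_trans (archi_boundP _) _.
  by rewrite divr_ge0 ?mulrn_wge0// ltW.
by rewrite ltr_nat.
Qed.

Lemma metrizable_quasi_interior : metrizable R (un_space X) ->
  exists e : X, quasi_interior_point e.
Proof.
move=> /metrizable_countable_base[a [u [a0 u0 base]]].
have [e e0 ue] := countable_ideal_bound u0; exists e.
apply: quasi_interiorP => // x r x0 r0.
(* The base is used at the neighborhood cut out by [x] itself: the excess lies below [x], so its
   meet with [x] is the excess, and membership bounds its norm by [r]. *)
have [k kP] := base _ _ r0 x0; have [m um] := ue k.
have [n nP] := norm_meet_excess_small e0 (u0 k) um x0 (a0 k); exists n.
have p0 : 0 <=v x - vmeet x (e *+ n) by rewrite vsubr_ge0 vmeet_lel.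
have := kP (x - vmeet x (e *+ n)); rewrite /un_ball0/= (modulus_id p0).
by rewrite (vmeet_idl (vleB _ _)); [exact | rewrite vmeet_ge0 ?vmulrn_ge0].
Qed.

End BanachLatticeFacts.

Theorem theorem3p2 (R : realType) (X : banachLatticeType R) :
  (metrizable R (un_space X) <-> exists e : X, quasi_interior_point e) /\
  (forall e : X, quasi_interior_point e ->
    is_metric (un_dist e) /\
    induces_topology (un_dist e : un_space X -> un_space X -> R)).
Proof.
split; last by move=> e qe; split; [exact: un_dist_metric | exact: un_dist_induces].
split=> [|[e qe]]; first exact: metrizable_quasi_interior.
by exists (un_dist e); split; [exact: un_dist_metric | exact: un_dist_induces].
Qed.
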